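(* For all $n\ge0$, we have $c_n(132,213)=F_n^2$.
   Context: A word $\pi=\pi_1\dots\pi_m$ over the positive integers contains the pattern $\sigma=\sigma_1\dots\sigma_k$ if there are indices $1\le i_1<\dots<i_k\le m$ such that for all $r,s\in\{1,\dots,k\}$: $\pi_{i_r}<\pi_{i_s}$ iff $\sigma_r<\sigma_s$, and $\pi_{i_r}=\pi_{i_s}$ iff $\sigma_r=\sigma_s$; otherwise $\pi$ avoids $\sigma$. $\mathcal{C}_n$ denotes the set of nonnesting permutations: arrangements (words) of the multiset $\{1,1,2,2,\dots,n,n\}$ that avoid the patterns $1221$ and $2112$ ($\mathcal{C}_0$ consists of the empty word only). For patterns $\sigma,\tau,\dots$, $c_n(\sigma,\tau,\dots)$ is the number of $\pi\in\mathcal{C}_n$ avoiding all of $\sigma,\tau,\dots$. $F_n$ is the $n$th Fibonacci number with the convention $F_0=F_1=1$ and $F_n=F_{n-1}+F_{n-2}$ for $n\ge2$. *)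

(* Defs.v *)
From mathcomp Require Import all_boot.

Set Implicit Arguments.
Unset Strict Implicit.
Unset Printing Implicit Defensive.

(* Indices are 0-based; [i r] is the position in [w] playing the role of the
   [r]-th letter of [sigma]. *)
Definition contains (w sigma : seq nat) : bool :=
  [exists i : {ffun 'I_(size sigma) -> 'I_(size w)},
    [forall r : 'I_(size sigma), forall s : 'I_(size sigma),
      [&& (r < s) ==> (i r < i s),
          (nth 0 w (i r) < nth 0 w (i s)) ==
            (nth 0 sigma r < nth 0 sigma s)
        & (nth 0 w (i r) == nth 0 w (i s)) ==
            (nth 0 sigma r == nth 0 sigma s)]]].

Definition avoids (w sigma : seq nat) : bool := ~~ contains w sigma.

(* The multiset {1,1,2,2,...,n,n}. *)
Definition double_multiset (n : nat) : seq nat :=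
  flatten [seq [:: k; k] | k <- iota 1 n].

(* [permutations] lists each distinct arrangement of a multiset exactly once,
   so this list is duplicate-free. *)
Definition nonnesting (n : nat) : seq (seq nat) :=
  [seq w <- permutations (double_multiset n)
     | avoids w [:: 1; 2; 2; 1] && avoids w [:: 2; 1; 1; 2]].

Definition c (n : nat) (patterns : seq (seq nat)) : nat :=
  count (fun w => all (avoids w) patterns) (nonnesting n).

(* Indexed so that F_0 = F_1 = 1. *)
Fixpoint fib (n : nat) : nat :=
  match n with
  | 0 => 1
  | m.+1 => match m with
            | 0 => 1
            | k.+1 => fib m + fib k
            end
  end.

(* Main.v *)
Require Import Defs.
From mathcomp Require Import all_boot zify.

Set Implicit Arguments.
Unset Strict Implicit.
Unset Printing Implicit Defensive.

(** The proof builds the permutations one largest letter at a time, and shows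
that the resulting generating tree is, up to a swap of coordinates, the square
of the Fibonacci tree.

Write N = n + 1 and let w be a valid word on 1, 1, ..., N, N, where valid
means nonnesting and avoiding 132 and 213.  Write w = A N B N C.  Erasing
both N leaves a valid word A B C, since all the conditions are inherited by
subsequences.  Conversely, the absence of forbidden patterns that involve N,
necessarily as their largest letter, translates into simple conditions on A, B
and C ([insertable], [good_insertion]).  They leave very few ways of inserting
N into a given valid word v ([childrenP]):
- N N v, always;
- N n N r, when v = n r;
- P n n N N S, when v = P n n S;
- n N n N r, when v = n n r.

So the number of children of v depends only on two booleans, its label: does v
start with n, and are the two copies of n adjacent?  The labels of the
children, in the order above, are (T, T), (T, F), (F, T) and (F, F)
([label_children]).  If both coordinates were swapped at each level, every
coordinate would evolve separately by the Fibonacci rule: T yields T and F, and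
F yields T.  Accordingly, the numbers of words of labels (T, T), (T, F),
(F, T) and (F, F) are p^2, p q, p q and q^2, where (p, q) becomes
(p + q, p) from one level to the next ([count_labels]).  The total is
(p + q)^2, and p + q is a Fibonacci number. *)

(** * Pattern containment through subsequences *)

Definition order_iso (s t : seq nat) : Prop :=
  size s = size t /\ forall i j, i < size t -> j < size t ->
    (nth 0 s i < nth 0 s j) = (nth 0 t i < nth 0 t j) /\
    (nth 0 s i == nth 0 s j) = (nth 0 t i == nth 0 t j).

(** Subsequences are easier to cut and paste than increasing maps between
positions; all the later arguments use them. *)
Lemma containsP w sigma :
  reflect (exists2 t, subseq t w & order_iso t sigma) (contains w sigma).
Proof.
apply: (iffP existsP) => [[f /forallP fP]|[t /subseqP[m _ ->] [szt iso]]].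
- have {}fP r s := forallP (fP r) s.
  exists [seq nth 0 w (f r) | r <- enum 'I_(size sigma)]; last first.
    split=> [|i j ltis ltjs]; first by rewrite size_map size_enum_ord.
    have nthE k (ltk : k < size sigma) :
        nth 0 [seq nth 0 w (f r) | r <- enum 'I_(size sigma)] k =
          nth 0 w (f (Ordinal ltk)).
      rewrite (nth_map (Ordinal ltk)) ?size_enum_ord //.
      by rewrite (nth_ord_enum _ (Ordinal ltk)).
    rewrite !nthE.
    by have /and3P[_ /eqP-> /eqP->] := fP (Ordinal ltis) (Ordinal ltjs).
  rewrite (map_comp (nth 0 w) (fun r => nat_of_ord (f r))).
  set u := map _ (enum _).
  suff: subseq u (iota 0 (size w)).
    by move/(map_subseq (nth 0 w)); rewrite -/(mkseq _ _) mkseq_nth.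
  have su : sorted ltn u.
    rewrite /u sorted_map.
    have: sorted ltn [seq val r | r <- enum 'I_(size sigma)].
      by rewrite val_enum_ord iota_ltn_sorted.
    rewrite sorted_map; apply: sub_sorted => r s /= ltrs.
    by have /and3P[/implyP-> //] := fP r s.
  (* an increasing list of positions is a filtering of all the positions *)
  suff -> : u = [seq i <- iota 0 (size w) | i \in u] by apply: filter_subseq.
  apply: (irr_sorted_eq ltn_trans ltnn su).
    by apply: (sorted_filter ltn_trans); apply: iota_ltn_sorted.
  move=> i; rewrite mem_filter mem_iota add0n leq0n /=.
  by case: (boolP (i \in u)) => //= /mapP[r _ ->]; rewrite ltn_ord.
- pose u := mask m (iota 0 (size w)).
  have Eu : mask m w = [seq nth 0 w i | i <- u].
    by rewrite -{1}[w](mkseq_nth 0) /mkseq -map_mask.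
  have su : sorted ltn u.
    by apply: (sorted_mask ltn_trans); apply: iota_ltn_sorted.
  have szu : size u = size sigma by rewrite -szt Eu size_map.
  have ltu (r : 'I_(size sigma)) : nth 0 u r < size w.
    have /mem_mask : nth 0 u r \in u by rewrite mem_nth // szu.
    by rewrite mem_iota.
  exists [ffun r => Ordinal (ltu r)].
  apply/forallP=> r; apply/forallP=> s; rewrite !ffunE /=.
  have nthu (q : 'I_(size sigma)) :
    nth 0 w (nth 0 u q) = nth 0 (mask m w) q by rewrite Eu (nth_map 0) ?szu.
  have [] := iso r s (ltn_ord r) (ltn_ord s); rewrite -!nthu => -> ->.
  rewrite !eqxx !andbT; apply/implyP => ltrs.
  by apply: (sorted_ltn_nth ltn_trans 0 su) => //; rewrite inE szu.
Qed.

Lemma avoids_nestingP w :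
  reflect (forall x y, x != y -> ~~ subseq [:: x; y; y; x] w)
    (avoids w [:: 1; 2; 2; 1] && avoids w [:: 2; 1; 1; 2]).
Proof.
apply: (iffP andP) => [[av1 av2] x y nexy | av].
- have iso a b : a < b -> order_iso [:: a; b; b; a] [:: 1; 2; 2; 1] /\
                          order_iso [:: b; a; a; b] [:: 2; 1; 1; 2].
    by move=> ltab; split; split=> // -[|[|[|[|i]]]] [|[|[|[|j]]]] //= _ _; lia.
  apply/negP => sub.
  case: (ltngtP x y) nexy => // ltxy _.
    by case/negP: av1; apply/containsP; exists [:: x; y; y; x];
      case: (iso _ _ ltxy).
  by case/negP: av2; apply/containsP; exists [:: x; y; y; x];
    case: (iso _ _ ltxy).
- split; apply/containsP => -[[|a [|b [|b' [|a' [|? ?]]]]]] sub [] // _ iso;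
  move: (iso 0 1 isT isT) (iso 0 3 isT isT) (iso 1 2 isT isT) =>
    /= [_ nab] [_ eaa] [_ ebb];
  case/negP: (av a b (negbT nab));
  by move: eaa ebb sub => /eqP-> /eqP->.
Qed.

Lemma avoids_132P w :
  reflect (forall a b c, a < b < c -> ~~ subseq [:: a; c; b] w)
    (avoids w [:: 1; 3; 2]).
Proof.
apply: (iffP idP) => [av a b c /andP[ltab ltbc] | av].
- apply: contra av => sub; apply/containsP; exists [:: a; c; b] => //.
  by split=> // -[|[|[|i]]] [|[|[|j]]] //= _ _; lia.
- apply/containsP => -[[|a [|c [|b [|? ?]]]]] sub [] // _ iso.
  move: (iso 0 2 isT isT) (iso 2 1 isT isT) => /= [ltab _] [ltbc _].
  by apply: (negP (av a b c _)) => //; rewrite ltab ltbc.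
Qed.

Lemma avoids_213P w :
  reflect (forall a b c, a < b < c -> ~~ subseq [:: b; a; c] w)
    (avoids w [:: 2; 1; 3]).
Proof.
apply: (iffP idP) => [av a b c /andP[ltab ltbc] | av].
- apply: contra av => sub; apply/containsP; exists [:: b; a; c] => //.
  by split=> // -[|[|[|i]]] [|[|[|j]]] //= _ _; lia.
- apply/containsP => -[[|b [|a [|c [|? ?]]]]] sub [] // _ iso.
  move: (iso 1 0 isT isT) (iso 0 2 isT isT) => /= [ltab _] [ltbc _].
  by apply: (negP (av a b c _)) => //; rewrite ltab ltbc.
Qed.

Lemma count_double_multiset n x :
  count_mem x (double_multiset n) = (0 < x <= n).*2.
Proof.
elim: n => [|n IHn]; first by case: x.
rewrite /double_multiset -[n.+1]addn1 iotaD map_cat flatten_cat count_cat.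
by rewrite -/(double_multiset n) IHn /= add1n; lia.
Qed.

(** * Valid words and the enumeration to be counted *)

Record good n w : Prop := Good {
  good_count : forall x, count_mem x w = (0 < x <= n).*2;
  good_nesting : forall x y, x != y -> ~~ subseq [:: x; y; y; x] w;
  good_132 : forall a b c, a < b < c -> ~~ subseq [:: a; c; b] w;
  good_213 : forall a b c, a < b < c -> ~~ subseq [:: b; a; c] w
}.

Definition avoiders n :=
  [seq w <- nonnesting n | all (avoids w) [:: [:: 1; 3; 2]; [:: 2; 1; 3]]].

Lemma avoidersP n w : reflect (good n w) (w \in avoiders n).
Proof.
rewrite !mem_filter mem_permutations /= andbT.
apply: (iffP and3P) => [[/andP[/avoids_132P a132 /avoids_213P a213]]|].
  move=> /avoids_nestingP anest /permP cnt; split=> // x.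
  by rewrite cnt count_double_multiset.
case=> cnt anest a132 a213; split.
- by apply/andP; split; [apply/avoids_132P|apply/avoids_213P].
- exact/avoids_nestingP.
by apply/allP=> x _; rewrite /= cnt count_double_multiset.
Qed.

Lemma avoiders_uniq n : uniq (avoiders n).
Proof. by rewrite !filter_uniq // permutations_uniq. Qed.

(** * Auxiliary facts on sequences *)

Lemma subseq_splitP (T : eqType) (s1 s2 : seq T) x w :
  subseq (s1 ++ x :: s2) w <->
  exists w1 w2, [/\ w = w1 ++ x :: w2, subseq s1 w1 & subseq s2 w2].
Proof.
split=> [|[w1 [w2 [-> sub1 sub2]]]]; last by rewrite cat_subseq //= eqxx.
elim: w s1 => [|y w IHw] [|z s1] //=.
- case: eqP => [<- sub2|_ sub]; first by exists [::], w.
  have [w1 [w2 [-> sub1 sub2]]] := IHw [::] sub.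
  by exists (y :: w1), w2; split.
- case: eqP => [<-|nezy] sub.
    have [w1 [w2 [-> sub1 sub2]]] := IHw _ sub.
    by exists (z :: w1), w2; split; rewrite //= eqxx.
  have [w1 [w2 [-> sub1 sub2]]] := IHw (z :: s1) sub.
  exists (y :: w1), w2; split=> //.
  exact: subseq_trans sub1 (subseq_cons _ _).
Qed.

Lemma count_mem2_notin (T : eqType) (x : T) A B C :
  count_mem x (A ++ x :: B ++ x :: C) = 2 ->
  [/\ x \notin A, x \notin B & x \notin C].
Proof.
rewrite !count_cat /= !count_cat /= eqxx => cnt.
by split; rewrite -has_pred1 has_count; lia.
Qed.

Lemma count_mem2_split (T : eqType) (x : T) w :
  count_mem x w = 2 -> exists A B C, w = A ++ x :: B ++ x :: C.
Proof.
move=> cnt; have /splitPr wE : x \in w by rewrite -has_pred1 has_count cnt.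
move: cnt; case: wE => p1 p2; rewrite count_cat /= eqxx.
case: (boolP (x \in p1)) => [/splitPr[A B] _|xp1].
  by exists A, B, p2; rewrite -catA.
rewrite (count_memPn xp1) => cnt.
have /splitPr[B C] : x \in p2 by rewrite -has_pred1 has_count; lia.
by exists p1, B, C.
Qed.

(** As [x] is not in [A], the occurrence of [x] displayed on the left is the
first one; the one displayed on the right is either the same or a later one. *)
Lemma cat_cons_inj (T : eqType) (x : T) A R w1 w2 :
  x \notin A -> A ++ x :: R = w1 ++ x :: w2 ->
  A = w1 /\ R = w2 \/ exists2 u, w1 = A ++ x :: u & R = u ++ x :: w2.
Proof.
elim: A w1 => [|y A IHA] [|z w1] //=.
- by move=> _ [->]; left.
- by move=> _ [<- ->]; right; exists w1.
- by rewrite inE negb_or => /andP[/eqP nexy _] [yx]; case: nexy.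
- rewrite inE negb_or => /andP[_ xA] [-> /(IHA _ xA)[[-> ->]|[u -> ->]]].
    by left.
  by right; exists u.
Qed.

(** * Inserting the two copies of a new largest letter *)

(** What it takes to turn a valid word [A ++ B ++ C] into a valid word
[A N B N C], where [N] exceeds all its letters.  A descent before the second
[N] would be the 21 of a 213; an ascent across an [N] would be the 12 of a
132.  In [ins_AC] the inequality is strict because [a N N a] is forbidden,
and [ins_uniq] holds because [N x x N] is. *)
Record insertable (A B C : seq nat) : Prop := Insertable {
  ins_sorted : sorted leq (A ++ B);
  ins_AB : forall a b, a \in A -> b \in B -> b <= a;
  ins_AC : forall a x, a \in A -> x \in C -> x < a;
  ins_BC : forall b x, b \in B -> x \in C -> x <= b;
  ins_uniq : uniq B
}.

Lemma good_le n w x : good n w -> x \in w -> 0 < x <= n.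
Proof.
by rewrite -has_pred1 has_count => /good_count->; rewrite double_gt0 lt0b.
Qed.

Lemma subseq_delete (T : eqType) (x : T) s A B :
  x \notin s -> subseq s (A ++ x :: B) -> subseq s (A ++ B).
Proof.
elim: A s => [|y A IHA] [|z s] //=; first by rewrite sub0seq.
all: rewrite inE negb_or => /andP[nexz xs].
  by rewrite eq_sym (negPf nexz).
by case: ifP => _; apply: IHA => //; rewrite inE negb_or nexz.
Qed.

Lemma filter_insert (T : eqType) (x : T) A B C : x \notin A ++ B ++ C ->
  [seq y <- A ++ x :: B ++ x :: C | y != x] = A ++ B ++ C.
Proof.
rewrite !mem_cat !negb_or => /and3P[xA xB xC].
have filt s : x \notin s -> [seq y <- s | y != x] = s.
  by move=> xs; apply/all_filterP/allP => y ys; apply: contraNneq xs => <-.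
by rewrite filter_cat /= eqxx filter_cat /= eqxx !filt.
Qed.

Lemma sorted_leqP s :
  (forall x y, subseq [:: x; y] s -> x <= y) -> sorted leq s.
Proof.
case: s => // x s; elim: s x => // y s IHs x le; apply/andP; split.
  by apply: le; rewrite /= !eqxx sub0seq.
by apply: IHs => a b sub; apply: le; apply: subseq_trans sub (subseq_cons _ _).
Qed.

Lemma subseq_uniq2 (T : eqType) (s : seq T) :
  (forall x, ~~ subseq [:: x; x] s) -> uniq s.
Proof.
elim: s => // x s IHs nsub; rewrite cons_uniq IHs => [|y].
  by rewrite andbT -sub1seq; have := nsub x; rewrite /= eqxx.
by apply: contra (nsub y) => sub; apply: subseq_trans sub (subseq_cons _ _).
Qed.

Lemma subseq_mem_cat (s t : seq nat) x y :
  x \in s -> y \in t -> subseq [:: x; y] (s ++ t).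
Proof. by move=> xs yt; rewrite -cat1s cat_subseq // sub1seq. Qed.

(** Going from right to left, a forbidden pattern of the extended word either
omits [N], and then lies in [A ++ B ++ C], or uses [N]; in the latter case the
two possible positions of that [N] contradict one of the fields of
[insertable]. *)
Lemma good_insertion n A B C :
  good n.+1 (A ++ n.+1 :: B ++ n.+1 :: C) <->
  good n (A ++ B ++ C) /\ insertable A B C.
Proof.
set N := n.+1; set w := A ++ _.
split=> [gw|[gv iABC]].
- have [NA NB NC] : [/\ N \notin A, N \notin B & N \notin C].
    by apply: count_mem2_notin; rewrite (good_count gw) leqnn.
  have NABC : N \notin A ++ B ++ C by rewrite !mem_cat !negb_or NA NB.
  have subw : subseq (A ++ B ++ C) w.
    by rewrite -(filter_insert NABC) -/w filter_subseq.
  have ltN x : x \in A ++ B ++ C -> x < N.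
    move=> xin; have := good_le gw (mem_subseq subw xin).
    by have := memPn NABC x xin; rewrite /N; lia.
  have ltNA x : x \in A -> x < N by move=> xin; rewrite ltN ?mem_cat ?xin.
  have ltNB x : x \in B -> x < N by move=> xin; rewrite ltN ?mem_cat ?xin ?orbT.
  have ltNC x : x \in C -> x < N by move=> xin; rewrite ltN ?mem_cat ?xin ?orbT.
  split; first split.
  + move=> x; have := good_count gw x;
      rewrite /w !count_cat /= !count_cat /= /N => cnt.
    have /count_memPn := NABC; rewrite !count_cat -/N => cnt0.
    case: (x =P N) cnt => [-> _|neN]; first by rewrite cnt0 /N; lia.
    have -> : (n.+1 == x) = false by apply/eqP => /esym.
    by move: neN; rewrite /N; lia.
  + by move=> x y nexy; apply: contra (good_nesting gw nexy) => /subseq_trans->.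
  + by move=> a b c lt; apply: contra (good_132 gw lt) => /subseq_trans->.
  + by move=> a b c lt; apply: contra (good_213 gw lt) => /subseq_trans->.
  + have subABw x y : subseq [:: x; y] (A ++ B) -> subseq [:: x; y; N] w.
      move=> sub; rewrite /w -cat_rcons catA.
      rewrite -[[:: x; y; N]]/([:: x; y] ++ [:: N]).
      rewrite cat_subseq //= ?eqxx ?sub0seq //; apply: subseq_trans sub _.
      by rewrite cat_subseq // -cats1 prefix_subseq.
    have subAw a x : a \in A -> x \in B ++ N :: C -> subseq [:: a; N; x] w.
      move=> aA xBC; rewrite /w -[[:: a; N; x]]/([:: a] ++ [:: N; x]).
      by rewrite cat_subseq ?sub1seq //= eqxx sub1seq.
    have subBw b x : b \in A ++ N :: B -> x \in C -> subseq [:: b; N; x] w.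
      move=> bB xC; rewrite /w -cat_cons catA.
      rewrite -[[:: b; N; x]]/([:: b] ++ [:: N; x]).
      by rewrite cat_subseq ?sub1seq //= eqxx sub1seq.
    split.
    * apply: sorted_leqP => x y sub; rewrite leqNgt; apply/negP => ltyx.
      have ltxN : x < N.
        have : x \in A ++ B by apply: (mem_subseq sub); rewrite inE eqxx.
        by rewrite mem_cat => /orP[/ltNA|/ltNB].
      apply: (negP (@good_213 _ _ gw y x N _)); first by rewrite ltyx.
      exact: subABw.
    * move=> a b aA bB; rewrite leqNgt; apply/negP => ltab.
      apply: (negP (@good_132 _ _ gw a b N _)); first by rewrite ltab ltNB.
      by apply: subAw; rewrite // mem_cat bB.
    * move=> a x aA xC; rewrite ltnNge leq_eqVlt; apply/norP; split.
        apply/negP => /eqP ax; subst x.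
        apply: (negP (@good_nesting _ _ gw a N _));
          first by rewrite neq_ltn ltNA.
        rewrite /w; apply/(subseq_splitP [:: a] [:: N; a]).
        exists A, (B ++ N :: C); split; rewrite ?sub1seq //.
        apply/(subseq_splitP [::] [:: a]); exists B, C.
        by rewrite sub0seq sub1seq.
      apply/negP => ltax.
      apply: (negP (@good_132 _ _ gw a x N _)); first by rewrite ltax ltNC.
      by apply: subAw; rewrite // mem_cat inE xC !orbT.
    * move=> b x bB xC; rewrite leqNgt; apply/negP => ltbx.
      apply: (negP (@good_132 _ _ gw b x N _)); first by rewrite ltbx ltNC.
      by apply: subBw; rewrite // mem_cat inE bB !orbT.
    * apply: subseq_uniq2 => x; apply/negP => sub.
      have xB : x \in B by apply: (mem_subseq sub); rewrite inE eqxx.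
      apply: (negP (@good_nesting _ _ gw N x _));
        first by rewrite neq_ltn ltNB ?orbT.
      rewrite /w; apply/(subseq_splitP [::] [:: x; x; N]).
      exists A, (B ++ N :: C); split; rewrite ?sub0seq //.
      apply/(subseq_splitP [:: x; x] [::]); exists B, C.
      by rewrite sub0seq.
- have ltN x : x \in A ++ B ++ C -> x < N by move/(good_le gv); rewrite /N; lia.
  have NABC : N \notin A ++ B ++ C by apply/negP => /ltN; rewrite ltnn.
  have := NABC; rewrite !mem_cat !negb_or => /and3P[NA NB NC].
  have leN x : x \in w -> x <= N.
    rewrite /w mem_cat inE mem_cat inE => xin.
    have [->|nex] := eqVneq x N; first by [].
    apply/ltnW/ltN; rewrite !mem_cat; move: xin; rewrite (negPf nex) /=.
    by [].
  have delN s : N \notin s -> subseq s w -> subseq s (A ++ B ++ C).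
    by move=> Ns /(subseq_delete Ns); rewrite !catA => /(subseq_delete Ns).
  have splitBC s1 s2 : subseq (s1 ++ N :: s2) (B ++ N :: C) ->
      subseq s1 B /\ subseq s2 C.
    case/subseq_splitP=> w1 [w2 [wE sub1 sub2]].
    have [[-> ->] //|[u _ CE]] := cat_cons_inj NB wE.
    by move: NC; rewrite CE mem_cat inE eqxx orbT.
  have splitN s1 s2 : subseq (s1 ++ N :: s2) w ->
      subseq s1 A /\ subseq s2 (B ++ N :: C) \/
      subseq s1 (A ++ N :: B) /\ subseq s2 C.
    case/subseq_splitP=> w1 [w2 [wE sub1 sub2]].
    have [[-> ->]|[u w1E wE']] := cat_cons_inj NA wE; first by left.
    have [[-> ->]|[u' _ CE]] := cat_cons_inj NB wE'; first by right;
      rewrite -w1E.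
    by move: NC; rewrite CE mem_cat inE eqxx orbT.
  split.
  + move=> x; have := good_count gv x;
      rewrite /w !count_cat /= !count_cat /= => cnt.
    have /count_memPn := NABC; rewrite !count_cat -/N => cnt0.
    case: (x =P N) cnt => [->|neN]; first by rewrite eqxx /N; lia.
    have -> : (N == x) = false by apply/eqP => /esym.
    by move: neN; rewrite /N; lia.
  + move=> x y nexy; apply/negP => sub.
    have [xN|nxN] := eqVneq x N.
      subst x; have nNy s : subseq [:: y; y; N] s -> N \in s.
        by move=> /mem_subseq->; rewrite // !inE eqxx !orbT.
      have [[_ sub']|[_ /nNy]] := splitN [::] [:: y; y; N] sub; last exact/negP.
      have [sub2 _] := splitBC [:: y; y] [::] sub'.
      by have := subseq_uniq sub2 (ins_uniq iABC); rewrite /= inE eqxx.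
    have [yN|nyN] := eqVneq y N.
      subst y; have [[xA sub']|[_ sub']] := splitN [:: x] [:: N; x] sub.
        have [_ xC] := splitBC [::] [:: x] sub'.
        have := @ins_AC _ _ _ iABC x x; rewrite -!sub1seq ltnn.
        by move=> /(_ xA xC).
      by case/negP: NC; apply: (mem_subseq sub'); rewrite inE eqxx.
    have /negP[] := good_nesting gv nexy; apply: delN sub.
    by rewrite !inE !(eq_sym N) (negPf nxN) (negPf nyN).
  + move=> a b c /andP[ltab ltbc]; apply/negP => sub.
    have lecN : c <= N by apply: leN; apply: (mem_subseq sub);
      rewrite !inE eqxx orbT.
    have [cN|ncN] := eqVneq c N; last first.
      apply: (negP (@good_132 _ _ gv a b c _)); first by rewrite ltab.
      by apply: delN sub; rewrite !inE; lia.
    subst c; have [] := splitN [:: a] [:: b] sub; rewrite !sub1seq !mem_cat inE.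
      case=> aA /or3P[bB|/eqP bN|bC].
      * by have := ins_AB iABC aA bB; lia.
      * by lia.
      * by have := ins_AC iABC aA bC; lia.
    case=> /or3P[aA|/eqP aN|aB] bC.
    * by have := ins_AC iABC aA bC; lia.
    * by lia.
    * by have := ins_BC iABC aB bC; lia.
  + move=> a b c /andP[ltab ltbc]; apply/negP => sub.
    have lecN : c <= N by apply: leN; apply: (mem_subseq sub);
      rewrite !inE eqxx !orbT.
    have [cN|ncN] := eqVneq c N; last first.
      apply: (negP (@good_213 _ _ gv a b c _)); first by rewrite ltab.
      by apply: delN sub; rewrite !inE; lia.
    suff sub2 : subseq [:: b; a] (A ++ B).
      have := subseq_sorted leq_trans sub2 (ins_sorted iABC).
      by rewrite /= andbT; lia.
    subst c; have [[sub2 _]|[sub2 _]] := splitN [:: b; a] [::] sub.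
      exact: subseq_trans sub2 (prefix_subseq _ _).
    by apply: subseq_delete sub2; rewrite !inE; lia.
Qed.

(** * The children of a valid word *)

Definition starts_with n (w : seq nat) := ohead w == Some n.

(** The letter after the first [n] is again [n].  The default value [n.+1] makes
this false for the empty word at [n = 0], whose only child is [1 1]. *)
Definition adjacent n (w : seq nat) := nth n.+1 w (index n w).+1 == n.

Definition children n v :=
  [:: n.+1, n.+1 & v] ::
  (if starts_with n v then [:: [:: n.+1, n, n.+1 & behead v]] else [::]) ++
  (if starts_with n v && adjacent n v
   then [:: [:: n, n.+1, n, n.+1 & drop 2 v]] else [::]) ++
  (if adjacent n v
   then [:: take (index n v).+2 v ++ [:: n.+1, n.+1 & drop (index n v).+2 v]]
   else [::]).

Lemma index_cat_cons (T : eqType) (x : T) P S :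
  x \notin P -> index x (P ++ x :: S) = size P.
Proof. by move=> xP; rewrite index_cat (negPf xP) /= eqxx addn0. Qed.

Lemma adjacent_cat n P S : n \notin P -> adjacent n (P ++ [:: n, n & S]).
Proof.
move=> nP; rewrite /adjacent index_cat_cons //.
by rewrite nth_cat leqNgt leqnSn subSnn.
Qed.

Lemma adjacentP n v : good n v -> adjacent n v ->
  exists P S, [/\ v = P ++ [:: n, n & S], n \notin P & n \notin S].
Proof.
move=> gv; case: n gv => [|n] gv.
  case: v gv => [|x v] // /good_le/(_ (mem_head _ _)).
  by case: x.
have cnt : count_mem n.+1 v = 2 by rewrite (good_count gv) leqnn.
have [P [Q [S vE]]] := count_mem2_split cnt.
move: cnt; rewrite {gv}vE => /count_mem2_notin[nP nQ nS].
rewrite /adjacent index_cat_cons // nth_cat leqNgt leqnSn subSnn /=.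
case: Q nQ => [|q Q] /=; first by exists P, S.
by rewrite inE eq_sym => /norP[/negPf->].
Qed.

Lemma sorted_leq_cat s t x y :
  sorted leq (s ++ t) -> x \in s -> y \in t -> x <= y.
Proof.
move=> st xs yt; have := subseq_sorted leq_trans (subseq_mem_cat xs yt) st.
by rewrite /= andbT.
Qed.

Lemma uniq_eq_seq1 (T : eqType) (x : T) s :
  s != [::] -> uniq s -> {in s, forall y, y = x} -> s = [:: x].
Proof.
case: s => [|y s] // _ us eqx.
have yx : y = x by apply: eqx; rewrite mem_head.
case: s us eqx => [_ _|z s us eqx]; first by rewrite yx.
have zx : z = x by apply: eqx; rewrite !inE eqxx orbT.
by move: us; rewrite yx zx /= mem_head.
Qed.

(** From right to left, recover the child from [A], [B] and [C].
If [B] is empty and [A] is not, then [A] is sorted and exceeds [C], so it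
contains both copies of [n], at its end.  If [B] is not empty but [A] is, the
letters of [B] have their second copy in [C], and dominate [C], which forces
[B = n].  If neither is empty, sortedness and [ins_AB] make all their letters
equal, and equal to [n] since [n] is not in [C].

From left to right, the conditions are immediate except for the insertion of
[N N] after an adjacent pair [n n] preceded by [P]: there [P] inherits its
conditions from the fact that [n n] itself was inserted after [P]. *)
Lemma childrenP n v w : good n v ->
  w \in children n v <-> exists A B C,
    [/\ w = A ++ n.+1 :: B ++ n.+1 :: C, v = A ++ B ++ C & insertable A B C].
Proof.
move=> gv; split=> [|[A [B [C [-> vE iABC]]]]].
- rewrite inE !mem_cat => /or4P[/eqP->|||].
  + by exists [::], [::], v; split=> //; split.
  + case: ifP => // /eqP; rewrite inE.
    case: v gv => //= x v gv [xn] /eqP->; subst x.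
    exists [::], [:: n], v; split=> //; split=> // b x;
      rewrite inE => /eqP-> xv.
    by have := good_le gv (mem_behead (s := n :: v) xv); lia.
  + case: ifP => // /andP[st /(adjacentP gv)[P [S [vE nP nS]]]].
    rewrite inE => /eqP->; move: st vE gv; case: P nP => [|p P] nP; last first.
      by move=> /[swap] -> /= /eqP[pn]; move: nP; rewrite pn inE eqxx.
    move=> _ -> gv /=; rewrite drop0.
    have leS x : x \in S -> x < n.
      move=> xS; have := good_le gv (mem_behead (s := n :: n :: S) _).
      move=> /(_ x); rewrite inE xS orbT => /(_ isT).
      by have := memPn nS x xS; lia.
    exists [:: n], [:: n], S; split=> //; split=> //=.
    * by rewrite leqnn.
    * by move=> a b; rewrite !inE => /eqP-> /eqP->.
    * by move=> a x; rewrite inE => /eqP->; apply: leS.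
    * by move=> a x; rewrite inE => /eqP-> /leS/ltnW.
  + case: ifP => // /(adjacentP gv)[P [S [vE nP nS]]].
    rewrite inE => /eqP->; rewrite vE index_cat_cons //.
    have -> : P ++ [:: n, n & S] = (P ++ [:: n; n]) ++ S by rewrite -catA.
    have sz : (size P).+2 = size (P ++ [:: n; n]) by rewrite size_cat addn2.
    rewrite sz take_size_cat // drop_size_cat //.
    exists (P ++ [:: n; n]), [::], S; split=> //.
    case: n gv nP nS vE {sz} => [|n] gv nP nS vE.
      by have /(good_le gv) : 0 \in v by rewrite vE mem_cat inE eqxx orbT.
    rewrite vE in gv.
    (* v itself arises from P ++ S by inserting its largest letter *)
    have [_ iPS] := (good_insertion n P [::] S).1 gv.
    have ltn_S x : x \in S -> x < n.+1.
      move=> xS; have := @good_le _ _ x gv.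
      rewrite mem_cat !inE xS !orbT => /(_ isT).
      by have := memPn nS x xS; lia.
    split=> //.
    * rewrite cats0 sorted_pairwise; last exact: leq_trans.
      rewrite pairwise_cat /= leqnn !andbT.
      rewrite -(sorted_pairwise leq_trans); have := ins_sorted iPS.
      rewrite cats0 => ->; rewrite andbT; apply/allrelP => x y xP.
      rewrite !inE orbb => /eqP->.
      by have := @good_le _ _ x gv; rewrite mem_cat xP => /(_ isT)/andP[].
    * move=> a x; rewrite mem_cat !inE orbb => /orP[aP|/eqP->];
        last exact: ltn_S.
      exact: (ins_AC iPS).
- have lev x : x \in A ++ B ++ C -> x <= n.
    by rewrite -vE => /(good_le gv)/andP[].
  have nv x : x \in A ++ B ++ C ->
      count_mem n A + count_mem n B + count_mem n C = 2.
    rewrite -vE => /(good_le gv) len;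
      rewrite -addnA -!count_cat -vE (good_count gv).
    by rewrite leqnn; lia.
  have notC a : a \in A -> n \notin C.
    move=> aA; apply/negP => /(ins_AC iABC aA).
    by have := lev a; rewrite mem_cat aA => /(_ isT); lia.
  have countB : count_mem n B <= 1
    by rewrite (count_uniq_mem _ (ins_uniq iABC)) leq_b1.
  rewrite /children !in_cons !mem_cat.
  have [BE|B0] := eqVneq B [::].
    subst B; case: A => [|a A0] in lev vE iABC nv notC *;
      first by rewrite vE eqxx.
    set A := a :: A0 in lev vE iABC nv notC *.
    have aA : a \in A by rewrite mem_head.
    have nC := notC a aA.
    have cntA : count_mem n A = 2.
      by have := nv a; rewrite mem_cat aA (count_memPn nC) /= !addn0 => ->.
    have [P [Q [S AE]]] := count_mem2_split cntA.
    have [nP nQ nS] : [/\ n \notin P, n \notin Q & n \notin S].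
      by apply: count_mem2_notin; rewrite -AE.
    have sA := ins_sorted iABC; rewrite cats0 AE -cat_rcons in sA.
    have QS x : x \in Q ++ n :: S -> x = n.
      move=> xin; apply/eqP; rewrite eqn_leq; apply/andP; split.
        apply: lev; rewrite AE -cat_rcons -catA mem_cat.
        by rewrite [x \in _ ++ C]mem_cat xin orbT.
      by apply: (sorted_leq_cat sA) xin; rewrite mem_rcons mem_head.
    have nil T : {subset T <= Q ++ n :: S} -> n \notin T -> T = [::].
      case: T => // t T /(_ t (mem_head _ _))/QS-> /negP[]; exact: mem_head.
    have Q0 : Q = [::] by apply: nil nQ => x xQ; rewrite mem_cat xQ.
    have S0 : S = [::] by apply: nil nS => x xS; rewrite mem_cat inE xS !orbT.
    subst Q S; have v2 : v = P ++ [:: n, n & C] by rewrite vE AE -catA.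
    rewrite v2 adjacent_cat // index_cat_cons //.
    have -> : P ++ [:: n, n & C] = A ++ C by rewrite AE -catA.
    have sz : (size P).+2 = size A by rewrite AE size_cat addn2.
    by rewrite sz take_size_cat // [drop (size A) _]drop_size_cat // mem_seq1
      eqxx !orbT.
  have [b bB] : exists b, b \in B.
    by case: (B) B0 => // b B'; exists b; rewrite mem_head.
  have cnt2 : count_mem n A + count_mem n B + count_mem n C = 2.
    by apply: (nv b); rewrite !mem_cat bB orbT.
  have [AE|A0] := eqVneq A [::].
    subst A; have nC : n \in C.
      by rewrite -has_pred1 has_count; move: cnt2;
        rewrite [count_mem n [::]]/=; lia.
    have BE : B = [:: n].
      apply: uniq_eq_seq1 (ins_uniq iABC) _ => // x xB; apply/eqP.
      by rewrite eqn_leq (ins_BC iABC xB nC) andbT lev // !mem_cat xB.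
    by rewrite vE BE /starts_with eqxx mem_seq1 eqxx !orbT.
  have [a aA] : exists a, a \in A.
    by case: (A) A0 => // a A'; exists a; rewrite mem_head.
  have nC := notC a aA.
  have nA : n \in A.
    rewrite -has_pred1 has_count; move: cnt2; rewrite (count_memPn nC); lia.
  have eqAB x y : x \in A -> y \in B -> x = y.
    move=> xA yB; apply/eqP; rewrite eqn_leq (ins_AB iABC xA yB) andbT.
    exact: sorted_leq_cat (ins_sorted iABC) xA yB.
  have BE : B = [:: n].
    by apply: uniq_eq_seq1 (ins_uniq iABC) _ => // x /(eqAB n x nA).
  have AE : A = [:: n].
    have Anseq : A = nseq (size A) n.
      apply/all_pred1P/allP => x xA; apply/eqP/eqAB => //.
      by rewrite BE mem_head.
    have cA : count_mem n A = 1.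
      by move: cnt2; rewrite BE (count_memPn nC) /= eqxx; lia.
    have szA : size A = 1.
      by move: cA; rewrite {1}Anseq count_nseq /= eqxx mul1n.
    by rewrite Anseq szA.
  rewrite vE AE BE /starts_with eqxx (@adjacent_cat n [::]) //.
  by rewrite /= drop0 !mem_seq1 eqxx !orbT.
Qed.

(** * Labels and the generating tree *)

Definition label n v := (starts_with n v, adjacent n v).

Definition next_labels (l : bool * bool) : seq (bool * bool) :=
  (true, true) ::
  (if l.1 then [:: (true, false)] else [::]) ++
  (if l.1 && l.2 then [:: (false, false)] else [::]) ++
  (if l.2 then [:: (false, true)] else [::]).

Lemma label_children n v :
  good n v -> [seq label n.+1 w | w <- children n v] = next_labels (label n v).
Proof.
move=> gv; rewrite /children /next_labels /= !map_cat.
congr (_ :: _ ++ _ ++ _).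
- by rewrite /label /starts_with /adjacent /= !eqxx.
- by case: ifP => //=; rewrite /label /starts_with /adjacent /= !eqxx /=
    ltn_eqF.
- case: ifP => //= _; rewrite /label /starts_with /adjacent /= eqxx.
  by rewrite !(ltn_eqF (ltnSn n)) /= (inj_eq Some_inj) !(ltn_eqF (ltnSn n)).
- case: ifP => //= /(adjacentP gv)[P [S [vE nP nS]]].
  have NP : n.+1 \notin P ++ [:: n; n].
    apply/negP => NP; suff /(good_le gv) : n.+1 \in v by rewrite ltnn.
    by rewrite vE -[_ ++ _]/(P ++ [:: n; n] ++ S) catA mem_cat NP.
  have sz : (size P).+2 = size (P ++ [:: n; n]) by rewrite size_cat addn2.
  rewrite vE index_cat_cons //.
  have -> : P ++ [:: n, n & S] = (P ++ [:: n; n]) ++ S by rewrite -catA.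
  rewrite sz take_size_cat // drop_size_cat // /label adjacent_cat //.
  rewrite /starts_with; case: (P) NP => [|x P'] /= /norP[]; last first.
    by rewrite (inj_eq Some_inj) eq_sym => /negPf->.
  by rewrite (inj_eq Some_inj) eq_sym => /negPf->.
Qed.

Lemma next_labels_uniq l : uniq (next_labels l).
Proof. by case: l => [[] []]. Qed.

(** The parent is recovered by erasing the largest letter, so distinct words
have disjoint sets of children. *)
Lemma good_filter_children n v w : good n v -> w \in children n v ->
  [seq x <- w | x != n.+1] = v.
Proof.
move=> gv /(childrenP _ gv)[A [B [C [-> vE _]]]].
rewrite filter_insert -?vE //.
by apply/negP => /(good_le gv); rewrite ltnn andbF.
Qed.

Lemma uniq_flatten_map (S T : eqType) (f : S -> seq T) (g : T -> S) s :
    uniq s -> {in s, forall x, uniq (f x)} ->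
    {in s, forall x, {in f x, forall y, g y = x}} ->
  uniq (flatten [seq f x | x <- s]).
Proof.
elim: s => //= x s IHs /andP[xs us] uf gf.
rewrite cat_uniq uf ?mem_head // IHs //; last first.
- by move=> y ys; apply: gf; rewrite inE ys orbT.
- by move=> y ys; apply: uf; rewrite inE ys orbT.
rewrite andbT /=; apply/hasPn => z /flatten_mapP[y ys zy]; apply/negP => zx.
have := gf x (mem_head _ _) z zx; rewrite (gf y _ z zy) ?inE ?ys ?orbT // => yx.
by move: xs; rewrite -yx ys.
Qed.

Lemma perm_avoiders n :
  perm_eq (avoiders n.+1) (flatten [seq children n v | v <- avoiders n]).
Proof.
apply: uniq_perm; first exact: avoiders_uniq.
  apply: (uniq_flatten_map (g := fun w => [seq x <- w | x != n.+1])).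
  - exact: avoiders_uniq.
  (* the children of a word are distinct as their labels are *)
  - move=> v /avoidersP gv; apply: (@map_uniq _ _ (label n.+1)).
    by rewrite label_children // next_labels_uniq.
  - by move=> v /avoidersP gv w; apply: good_filter_children.
move=> w; apply/avoidersP/flatten_mapP => [gw|[v /avoidersP gv]].
  have [A [B [C wE]]] : exists A B C, w = A ++ n.+1 :: B ++ n.+1 :: C.
    by apply: count_mem2_split; rewrite (good_count gw) leqnn.
  move: gw; rewrite wE => /good_insertion[gv iABC].
  exists (A ++ B ++ C); first exact/avoidersP.
  by apply/(childrenP _ gv); exists A, B, C.
by case/(childrenP _ gv) => A [B [C [-> vE iABC]]]; apply/good_insertion;
  rewrite -vE.
Qed.

Definition labels n := [seq label n v | v <- avoiders n].

Lemma perm_labels n :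
  perm_eq (labels n.+1) (flatten [seq next_labels l | l <- labels n]).
Proof.
rewrite (perm_trans (perm_map _ (perm_avoiders n))) //.
rewrite map_flatten -!map_comp; apply/permP => p; congr (count _ (flatten _)).
by apply/eq_in_map => v /avoidersP/label_children.
Qed.

(** * Counting *)

Lemma count_next_labels s (s' := flatten [seq next_labels l | l <- s]) :
  [/\ count_mem (true, true) s' = size s,
      count_mem (true, false) s' =
        count_mem (true, true) s + count_mem (true, false) s,
      count_mem (false, true) s' =
        count_mem (true, true) s + count_mem (false, true) s &
      count_mem (false, false) s' = count_mem (true, true) s].
Proof.
rewrite {}/s'; elim: s => //= l s [IH1 IH2 IH3 IH4].
by rewrite !count_cat IH1 IH2 IH3 IH4; case: l => [[] []] /=; split; lia.
Qed.

Lemma size_labels (s : seq (bool * bool)) :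
  size s = count_mem (true, true) s + count_mem (true, false) s +
    (count_mem (false, true) s + count_mem (false, false) s).
Proof. by elim: s => //= -[[] []] s ->; rewrite /=; lia. Qed.

(** The pair [(p, q)] consists of the Fibonacci numbers of indices [n - 1] and
[n - 2]; giving it by its sums with the next values avoids negative indices at
[n = 0], where it is [(0, 1)]. *)
Lemma count_labels n : exists p q,
  [/\ p + q = fib n, p.*2 + q = fib n.+1 & [/\
      count_mem (true, true) (labels n) = p ^ 2,
      count_mem (true, false) (labels n) = p * q,
      count_mem (false, true) (labels n) = p * q &
      count_mem (false, false) (labels n) = q ^ 2]].
Proof.
elim: n => [|n [p [q [fn fn1 [cTT cTF cFT cFF]]]]].
  exists 0, 1.
  have -> : labels 0 = [:: (false, false)].
    rewrite /labels; suff -> : avoiders 0 = [:: [::]] by [].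
    apply: perm_small_eq => //; apply: uniq_perm => //;
      first exact: avoiders_uniq.
    move=> w; rewrite inE; apply/avoidersP/eqP => [|->]; last by split=> // -[].
    by case: w => // x w /good_le/(_ (mem_head _ _)); case: x.
  by [].
exists (p + q), p.
have /permP cnt := perm_labels n.
have [nTT nTF nFT nFF] := count_next_labels (labels n).
rewrite !cnt nTT nTF nFT nFF size_labels cTT cTF cFT cFF.
by split; rewrite -?[fib n.+2]/(fib n.+1 + fib n); [lia | lia | split; lia].
Qed.

Theorem theorem2p6 (n : nat) :
  c n [:: [:: 1; 3; 2]; [:: 2; 1; 3]] = fib n ^ 2.
Proof.
rewrite /c -size_filter -/(avoiders n) -(size_map (label n)) -/(labels n).
have [p [q [<- _ [cTT cTF cFT cFF]]]] := count_labels n.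
by rewrite size_labels cTT cTF cFT cFF; nia.
Qed.
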